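(* Let $X$ be a random vector in $\mathbb{R}^D$ and $Y$ a real random variable. Let $P = AA^\top$ be the orthogonal projection onto $\operatorname{Im}(A)$, where $A\in\mathbb{R}^{D\times d}$ has orthonormal columns, and assume: (i) $\operatorname{Im}(P)$ is the minimal-dimensional subspace such that $Y$ is conditionally independent of $X$ given $PX$; (ii) $\mathbb{E}[X \mid PX] = PX$ almost surely. Then, for every $J$ and every partition $\mathcal{R}_{J,1},\dots,\mathcal{R}_{J,J}$ of the range of $Y$, one has $b_{J,\ell} \in \operatorname{Im}(A)$ for every $\ell \in \{1,\dots,J\}$. Moreover, $\operatorname{Im}(M_J) \subseteq \operatorname{Im}(A)$, with equality if $\lambda_d(M_J) > 0$.
   Context: For $J\in\mathbb{N}$, let $\operatorname{Im}(Y) = \bigcup_{\ell=1}^J \mathcal{R}_{J,\ell}$ be a partition of the range of $Y$ into $J$ measurable sets (level sets, e.g. intervals), with $\rho_{J,\ell} := \mathbb{P}(Y\in\mathcal{R}_{J,\ell})>0$. $X$ and $Y$ have finite second moments. Define $\Sigma_{J,\ell} := \operatorname{Cov}(X \mid Y\in\mathcal{R}_{J,\ell})\in\mathbb{R}^{D\times D}$ (the covariance matrix of $X$ conditioned on the event $Y\in\mathcal{R}_{J,\ell}$), and $$b_{J,\ell} := \Sigma_{J,\ell}^{\dagger}\operatorname{Cov}(X,Y \mid Y\in\mathcal{R}_{J,\ell})\in\mathbb{R}^D,\qquad M_J := \sum_{\ell=1}^J \rho_{J,\ell}\, b_{J,\ell} b_{J,\ell}^\top ,$$ where $\dagger$ denotes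 the Moore-Penrose pseudoinverse and $\operatorname{Cov}(X,Y\mid Y\in\mathcal{R}_{J,\ell})$ is the cross-covariance vector conditioned on the event. $\lambda_1(M)\ge\dots\ge\lambda_D(M)$ denote the ordered eigenvalues of a symmetric matrix $M\in\mathbb{R}^{D\times D}$. *)

(* Defs.v *)
From mathcomp Require Import all_boot all_order all_algebra.
From mathcomp Require Import all_classical all_reals all_analysis.
From mathcomp Require complex.

Set Implicit Arguments.
Unset Strict Implicit.
Unset Printing Implicit Defensive.

Import Order.TTheory GRing.Theory Num.Theory.
Import numFieldNormedType.Exports.

Local Open Scope classical_set_scope.
Local Open Scope ring_scope.

Section linear_algebra.
Variable R : realType.

Definition colspace m n (A : 'M[R]_(m, n)) : set 'cV[R]_m :=
  range (fun v : 'cV[R]_n => A *m v).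

Definition is_orthoproj n (Q : 'M[R]_n) : Prop := Q^T = Q /\ Q *m Q = Q.

(* The four Penrose equations. *)
Definition is_mpinv m n (A : 'M[R]_(m, n)) (B : 'M[R]_(n, m)) : Prop :=
  [/\ A *m B *m A = A, B *m A *m B = B,
      (A *m B)^T = A *m B & (B *m A)^T = B *m A].

Definition mpinv m n (A : 'M[R]_(m, n)) : 'M[R]_(n, m) :=
  xget 0 [set B | is_mpinv A B].

Lemma is_mpinv_inj m n (A : 'M[R]_(m, n)) B C :
  is_mpinv A B -> is_mpinv A C -> B = C.
Proof.
case=> ABA BAB ABt BAt [ACA CAC ACt CAt].
have eAB : A *m B = A *m C.
  by rewrite -ABt -{1}ACA -(mulmxA (A *m C)) trmx_mul ABt ACt mulmxA ABA.
have eBA : B *m A = C *m A.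
  by rewrite -BAt -{1}ACA -(mulmxA A) mulmxA trmx_mul BAt CAt -mulmxA
     (mulmxA A) ABA.
by rewrite -BAB eBA -mulmxA eAB mulmxA CAC.
Qed.

Lemma gram_unitmx m n (C : 'M[R]_(m, n)) : row_free C -> C *m C^T \in unitmx.
Proof.
move=> Cfree; rewrite -row_free_unit; apply: inj_row_free => v /= vCC.
have : (v *m C) *m (v *m C)^T = 0
  by rewrite trmx_mul mulmxA -(mulmxA v) vCC mul0mx.
move/matrixP/(_ 0 0); rewrite !mxE => s0.
have vC0 : v *m C = 0.
  apply/rowP => j; apply/eqP; rewrite [X in _ == X]mxE -sqrf_eq0 expr2.
  move: s0 => /eqP; rewrite psumr_eq0 => [/allP/(_ j)|i _].
    by rewrite mem_index_enum => /(_ isT); rewrite /= [X in _ * X == _ -> _]mxE.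
  by rewrite [X in _ * X]mxE -expr2 sqr_ge0.
exact: (row_free_inj Cfree (etrans vC0 (esym (mul0mx _ _)))).
Qed.

Lemma mpinvP m n (A : 'M[R]_(m, n)) : is_mpinv A (mpinv A).
Proof.
apply: (xgetPex 0 (P := [set B | is_mpinv A B])).
have uF := gram_unitmx (row_base_free A).
have uC : (col_base A)^T *m (col_base A)^T^T \in unitmx.
  apply: gram_unitmx; rewrite -row_leq_rank mxrank_tr.
  by have := col_base_full A; rewrite -col_leq_rank.
move: (\rank A) (row_base A) (col_base A) (mulmx_base A) uF uC => r F C <-.
rewrite trmxK => uF uC.
pose iF := F^T *m invmx (F *m F^T); pose iC := invmx (C^T *m C) *m C^T.
have FiF : F *m iF = 1%:M by rewrite mulmxA mulmxV.
have iCC : iC *m C = 1%:M by rewrite -mulmxA mulVmx.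
have AB : C *m F *m (iF *m iC) = C *m iC.
  by rewrite -mulmxA (mulmxA F) FiF mul1mx.
have BA : iF *m iC *m (C *m F) = iF *m F.
  by rewrite -mulmxA (mulmxA iC) iCC mul1mx.
exists (iF *m iC); split; rewrite ?AB ?BA.
- by rewrite -mulmxA (mulmxA iC) iCC mul1mx.
- by rewrite -mulmxA (mulmxA F) FiF mul1mx.
- by rewrite /iC !trmx_mul trmxK trmx_inv trmx_mul trmxK mulmxA.
- by rewrite /iF !trmx_mul trmxK trmx_inv trmx_mul trmxK mulmxA.
Qed.

(* Nonincreasing list of eigenvalues, repeated according to multiplicity. *)
Definition is_spectrum n (M : 'M[R]_n) (s : seq R) : Prop :=
  sorted (fun x y => y <= x) s /\ char_poly M = \prod_(x <- s) ('X - x%:P).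

Definition spectrum n (M : 'M[R]_n) : seq R :=
  xget [::] [set s | is_spectrum M s].

(* lambda 1 M >= ... >= lambda n M; lambda 0 M is junk, equal to lambda 1 M. *)
Definition lambda k n (M : 'M[R]_n) : R := nth 0 (spectrum M) k.-1.

Import complex.

Lemma spectrumP n (M : 'M[R]_n) : M^T = M -> is_spectrum M (spectrum M).
Proof.
move=> Msym; apply: (xgetPex [::] (P := [set s | is_spectrum M s])).
pose C : numClosedFieldType := complex R.
pose f : {rmorphism R -> C} := real_complex R.
have fK : cancel f (@Re R) by [].
pose MC := map_mx f M.
have MCh : MC \is hermsymmx.
  apply: realsym_hermsym.
    apply/is_hermitianmxP; rewrite expr0 scale1r map_mx_id //.
    by rewrite /MC map_trmx Msym.
  by apply/mxOverP => i j; rewrite mxE complex_real.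
pose Q := spectralmx MC; pose D := spectral_diag MC.
have Qu : Q \in unitmx := spectral_unit MC.
have /orthomx_spectralP MCE := hermitian_normalmx MCh.
have Dr i : f (Re (D 0 i)) = D 0 i.
  have /mxOverP/(_ 0 i) := hermitian_spectral_diag_real MCh.
  by move=> /RRe_real.
pose s0 := [seq Re (D 0 i) | i : 'I_n].
exists (sort (fun x y => y <= x) s0); split; first exact/sort_sorted/ge_total.
rewrite (perm_big s0) ?perm_sort //.
apply: (map_poly_inj f); rewrite map_char_poly rmorph_prod /s0 /= -/MC.
rewrite big_image /=.
pose QX := map_mx polyC Q; pose QV := map_mx polyC (invmx Q).
have QVQ : QV *m QX = 1%:M by rewrite -map_mxM mulVmx // map_mx1.
transitivity (char_poly (diag_mx D)).
  rewrite /char_poly /char_poly_mx MCE !map_mxM -/QX -/QV.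
  rewrite [in LHS](_ : 'X%:M = QV *m 'X%:M *m QX); last first.
    by rewrite scalar_mxC -mulmxA QVQ mulmx1.
  rewrite -mulmxBl -mulmxBr !det_mulmx mulrC mulrA -det_mulmx.
  by rewrite (mulmx1C QVQ) det1 mul1r.
rewrite char_poly_trig ?diag_mx_is_trig //; apply: eq_bigr => i _.
by rewrite mxE eqxx mulr1n rmorphB /= map_polyX map_polyC /= Dr.
Qed.

End linear_algebra.

Section conditioning.
Context d (T : measurableType d) (R : realType) (Pr : probability T R).

(* V is a version of E[U | G], for an integrable U and a sub-sigma-algebra G. *)
Definition is_cond_exp (G : set (set T)) (U V : T -> R) : Prop :=
  [/\ forall B : set R, measurable B -> G (V @^-1` B),
      Pr.-integrable setT (EFin \o V) &
      forall E, G E ->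
        (\int[Pr]_(x in E) (V x)%:E = \int[Pr]_(x in E) (U x)%:E)%E].

(* P(A | G) P(B | G) is a version of P(A `&` B | G); versions are a.s. unique,
   so it does not matter which pA and pB are chosen. *)
Definition cond_indep (F H G : set (set T)) : Prop :=
  forall A B, F A -> H B -> exists pA pB : T -> R,
    [/\ is_cond_exp G \1_A pA, is_cond_exp G \1_B pB &
        is_cond_exp G \1_(A `&` B) (fun t => pA t * pB t)].

(* E[U | E] for an event E of positive probability. *)
Definition event_exp (E : set T) (U : T -> R) : R :=
  (\int[Pr]_(x in E) U x) / fine (Pr E).

Definition event_cov (E : set T) (U V : T -> R) : R :=
  event_exp E (fun t => (U t - event_exp E U) * (V t - event_exp E V)).

End conditioning.

Section regression.
Context d (T : measurableType d) (R : realType) (Pr : probability T R).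
Context (D : nat) (X : 'I_D -> {RV Pr >-> R}) (Y : {RV Pr >-> R}).

(* i-th coordinate of the random vector Q X. *)
Definition mulRV (Q : 'M[R]_D) (i : 'I_D) (t : T) : R :=
  (Q *m \col_j X j t) i 0.

(* Y is conditionally independent of X given Q X. *)
Definition sufficient (Q : 'M[R]_D) : Prop :=
  cond_indep Pr (preimage_set_system setT Y measurable)
    (g_sigma_preimage (fun i => X i : T -> R)) (g_sigma_preimage (mulRV Q)).

(* Subspaces of R^D are represented by their orthogonal projections, the
   dimension being the rank. *)
Definition minimal_sufficient (Q : 'M[R]_D) : Prop :=
  [/\ is_orthoproj Q, sufficient Q &
      forall Q', is_orthoproj Q' -> sufficient Q' -> (\rank Q <= \rank Q')%N].

(* The L l are measurable as subsets of range Y, that is, for the trace of the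
   Borel sigma-algebra: range Y itself need not be Borel. *)
Definition level_partition J (L : 'I_J -> set R) : Prop :=
  [/\ partition setT L (range Y),
      (forall l, exists2 B, measurable B & L l = range Y `&` B) &
      forall l, (0 < Pr (Y @^-1` L l))%E].

Definition Sigma_ (E : set R) : 'M[R]_D :=
  \matrix_(i, j) event_cov Pr (Y @^-1` E) (X i) (X j).

Definition b_ (E : set R) : 'cV[R]_D :=
  mpinv (Sigma_ E) *m \col_i event_cov Pr (Y @^-1` E) (X i) Y.

Definition M_ J (L : 'I_J -> set R) : 'M[R]_D :=
  \sum_(l < J) fine (Pr (Y @^-1` L l)) *: (b_ (L l) *m (b_ (L l))^T).

End regression.

(* Main.v *)
Require Import Defs.
From mathcomp Require Import all_boot all_order all_algebra.
From mathcomp Require Import all_classical all_reals all_analysis.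
From mathcomp Require Import measurable_realfun ring.

Set Implicit Arguments.
Unset Strict Implicit.
Unset Printing Implicit Defensive.

Import Order.TTheory GRing.Theory Num.Theory.
Import numFieldNormedType.Exports.

Local Open Scope classical_set_scope.
Local Open Scope ring_scope.

(** Write W = X - PX for the residual.  The point is that, inside any event
    E = (Y in B), the residual W has mean zero and is uncorrelated both with
    PX and with Y.  Since E[W | PX] = 0, conditional independence of Y and X
    given PX upgrades this to E[W; A, C] = 0 for all A in sigma(Y) and C in
    sigma(PX) ([cond_indep_centered]): heuristically
    E[1_A W | PX] = P(A | PX) E[W | PX] = 0.  A random variable that integrates
    to zero over all level sets of some V also integrates to zero against V
    ([Rintegral_mul_eq0]); used with V = PX and V = Y this kills the conditional
    covariances Cov(W, PX | E) and Cov(W, Y | E).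

    In matrix terms, with S = Cov(X | E) and c = Cov(X, Y | E), this says
    S P = P S P and P c = c.  As S is symmetric, P commutes with S, hence with
    its pseudoinverse S' ([mpinv_orthoproj_fixed]), so b = S' c satisfies
    P b = S' P c = b and lies in Im A.  Summing over the level sets, M = P M, so
    that Im M is contained in Im A.

    For the equality, a positive d-th eigenvalue means that M has at least d
    nonzero eigenvalues counted with multiplicity, so that M has rank at least d
    ([lambda_gt0_rank]), while A has only d columns.  The comparison of
    algebraic multiplicities with the rank comes from a full rank factorization
    M = C F and from the relation between the characteristic polynomials of C F
    and F C. *)

(** * Rank, spectrum and pseudoinverse *)

(** Both sides equal det N * X^r for the block matrix N = [X, C; F, 1].  Column
    operations of determinant 1 turn N into [X - C F, C; 0, 1], and right
    multiplication by [1, -C; 0, X], of determinant X^r, turns it into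
    [X, 0; F, X - F C]. *)
Lemma char_poly_mulmxC (R : comNzRingType) n r
    (C : 'M[R]_(n, r)) (F : 'M[R]_(r, n)) :
  char_poly (C *m F) * 'X^r = 'X^n * char_poly (F *m C).
Proof.
pose c := map_mx polyC C; pose f := map_mx polyC F.
have split1 : \det (block_mx 'X%:M c f 1%:M) = char_poly (C *m F).
  transitivity (\det (block_mx 'X%:M c f 1%:M *m block_mx 1%:M 0 (- f) 1%:M)).
    by rewrite det_mulmx det_lblock !det1 !mulr1.
  rewrite mulmx_block !mulmx0 !mulmx1 !mul1mx subrr !add0r det_ublock det1 mulr1.
  by rewrite /char_poly /char_poly_mx map_mxM mulmxN.
rewrite -split1 -(det_scalar r 'X).
transitivity (\det (block_mx 'X%:M c f 1%:M *m block_mx 1%:M (- c) 0 'X%:M)).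
  by rewrite det_mulmx det_ublock det1 mul1r.
rewrite mulmx_block !mulmx0 !mulmx1 !mul1mx !addr0 mul_scalar_mx mul_mx_scalar.
rewrite scalerN addNr det_lblock det_scalar.
by rewrite /char_poly /char_poly_mx map_mxM mulmxN addrC.
Qed.

(** With a full rank factorization M = C F the previous identity shows that X
    divides the characteristic polynomial of M at least n - rank M times; it
    does so exactly as often as 0 occurs in the spectrum. *)
Lemma count_nonzero_spectrum_rank (R : realType) n (M : 'M[R]_n) (s : seq R) :
  is_spectrum M s -> (count (predC1 (0 : R)%R) s <= \rank M)%N.
Proof.
case=> _ chM.
have size_s : size s = n.
  by have := size_char_poly M; rewrite chM size_prod_XsubC => -[].
have := char_poly_mulmxC (col_base M) (row_base M).
rewrite mulmx_base chM => eqX.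
have nz_char k (N : 'M[R]_k) : char_poly N != 0.
  exact/monic_neq0/char_poly_monic.
(* Multiplicities are stated for powers of X - a, hence this form of X^k. *)
have XnE k : 'X^k = ('X - (0 : R)%:P) ^+ k by rewrite subr0.
have Xn0 k : 'X^k != 0 :> {poly R} by rewrite -size_poly_eq0 size_polyXn.
have : (n <= count_mem (0 : R)%R s + \rank M)%N.
  have <- : mup 0 (\prod_(x <- s) ('X - x%:P) * 'X^(\rank M)) =
            (count_mem (0 : R)%R s + \rank M)%N.
    rewrite mupM ?Xn0 -?chM ?nz_char // chM mu_prod_XsubC XnE mup_XsubCX eqxx.
    by [].
  by rewrite eqX mupM ?Xn0 ?nz_char // XnE mup_XsubCX eqxx leq_addr.
by rewrite -[X in (X <= _)%N]size_s -(count_predC (pred1 (0 : R))) leq_add2l.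
Qed.

(** The spectrum is nonincreasing, so its first d entries are all positive. *)
Lemma lambda_gt0_rank (R : realType) n (M : 'M[R]_n) d :
  M^T = M -> 0 < lambda d M -> (d <= \rank M)%N.
Proof.
move=> Msym; rewrite /lambda; case: d => [//|d] /= lam_gt0.
have specM := spectrumP Msym; have [sorted_s _] := specM.
move: (spectrum M) specM sorted_s lam_gt0 => s specM sorted_s lam_gt0.
apply: leq_trans (count_nonzero_spectrum_rank specM).
have d_lt : (d < size s)%N.
  by rewrite ltnNge; apply: contraTN lam_gt0 => ?; rewrite nth_default ?ltxx.
rewrite -[s](cat_take_drop d.+1) count_cat.
apply: leq_trans (leq_addr _ _).
have -> : count (predC1 (0 : R)) (take d.+1 s) = size (take d.+1 s).
  apply/eqP; rewrite -all_count; apply/(all_nthP 0) => i.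
  rewrite size_takel // => i_lt; rewrite nth_take // /= gt_eqF //.
  apply: lt_le_trans lam_gt0 _.
  apply: (sorted_leq_nth _ _ _ sorted_s) => //; rewrite ?inE //.
  - by move=> x y z /= yx xz; exact: le_trans xz yx.
  - exact: leq_ltn_trans d_lt.
by rewrite size_takel.
Qed.

(** Conjugating by the symmetric involution U preserves the Penrose equations
    when U commutes with S, so that U S' U is again a pseudoinverse of S, where
    S' is mpinv S, and uniqueness gives U S' U = S'. *)
Lemma mpinv_reflection (R : realType) n (S U : 'M[R]_n) :
  U^T = U -> U *m U = 1%:M -> U *m S = S *m U -> U *m mpinv S = mpinv S *m U.
Proof.
move=> Usym UU US.
have [SBS BSB SBt BSt] := mpinvP S.
have USU : U *m S *m U = S by rewrite US -mulmxA UU mulmx1.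
suff UBU : U *m mpinv S *m U = mpinv S.
  by rewrite -[in RHS]UBU -mulmxA UU mulmx1.
have SB : S *m (U *m mpinv S *m U) = U *m (S *m mpinv S) *m U.
  by rewrite !mulmxA US.
have BS : (U *m mpinv S *m U) *m S = U *m (mpinv S *m S) *m U.
  by rewrite -!mulmxA US.
apply: is_mpinv_inj (mpinvP S); split; rewrite ?SB ?BS.
- by rewrite -(mulmxA _ U) US !mulmxA -(mulmxA U) -(mulmxA U) SBS USU.
- rewrite !mulmxA -(mulmxA (U *m mpinv S *m S) U U) UU mulmx1.
  by rewrite -(mulmxA U) -(mulmxA U) BSB.
- by rewrite !trmx_mul Usym -trmx_mul SBt mulmxA.
- by rewrite !trmx_mul Usym -trmx_mul BSt mulmxA.
Qed.

(** The reflection 2P - 1 is a symmetric involution with the same fixed vectors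
    as P, which allows conjugating by it instead of handling the projection. *)
Lemma mpinv_orthoproj_fixed (R : realType) n (P S : 'M[R]_n) (c : 'cV[R]_n) :
  is_orthoproj P -> P *m S = S *m P -> P *m c = c ->
  P *m (mpinv S *m c) = mpinv S *m c.
Proof.
move=> [Psym PP] PS Pc; pose U : 'M[R]_n := 2 *: P - 1%:M.
have Ut : U^T = U by rewrite /U linearB /= linearZ /= Psym trmx1.
have UU : U *m U = 1%:M.
  rewrite /U mulmxBl mul1mx mulmxBr mulmx1 -scalemxAl -scalemxAr PP.
  by rewrite [2 *: (2 *: P)]scaler_nat mulr2n addrK opprB addrC subrK.
have US : U *m S = S *m U.
  by rewrite /U mulmxBl mulmxBr mulmx1 mul1mx -scalemxAl -scalemxAr PS.
have Uc : U *m c = c.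
  by rewrite mulmxBl mul1mx -scalemxAl Pc scaler_nat mulr2n addrK.
have : U *m (mpinv S *m c) = mpinv S *m c.
  by rewrite mulmxA (mpinv_reflection Ut UU US) -mulmxA Uc.
rewrite mulmxBl mul1mx -scalemxAl => /eqP; rewrite subr_eq -mulr2n.
by rewrite -(scaler_nat 2 (mpinv S *m c)) => /eqP/scalerI; apply; rewrite pnatr_eq0.
Qed.

Lemma colspace_mulmx (R : realType) m n p
    (A : 'M[R]_(m, n)) (K : 'M[R]_(n, p)) :
  colspace (A *m K) `<=` colspace A.
Proof. by move=> _ [v _ <-]; exists (K *m v) => //; rewrite mulmxA. Qed.

Lemma colspace_mulmx_full (R : realType) m n p
    (A : 'M[R]_(m, n)) (K : 'M[R]_(n, p)) :
  (n <= \rank (A *m K))%N -> colspace (A *m K) = colspace A.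
Proof.
move=> rk; apply/seteqP; split; first exact: colspace_mulmx.
have : (A^T <= (A *m K)^T)%MS.
  have sub : ((A *m K)^T <= A^T)%MS by rewrite trmx_mul submxMl.
  rewrite -(geq_leqif (mxrank_leqif_sup sub)) !mxrank_tr.
  exact: leq_trans (rank_leq_col A) rk.
case/submxP=> K' /(congr1 trmx); rewrite trmxK trmx_mul trmxK => eqA.
by rewrite [in X in X `<=` _]eqA; exact: colspace_mulmx.
Qed.

(** * Integrals of a function that vanish on the level sets of another one *)

Lemma Rintegral_eq0P d (T : measurableType d) (R : realType)
    (mu : {measure set T -> \bar R}) (D : set T) (f : T -> R) :
  measurable D -> mu.-integrable D (EFin \o f) ->
  \int[mu]_(x in D) f x = 0 <-> (\int[mu]_(x in D) (f x)%:E = 0)%E.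
Proof.
move=> mD intf; split=> [f0|]; last by rewrite /Rintegral => ->.
by rewrite -[LHS]fineK ?integrable_fin_num // -/(Rintegral _ _ _) f0.
Qed.

Section simple_approximation.
Import HBNNSimple.

(** A simple function of V takes finitely many values, and on each of its level
    sets, which is of the form V^-1(B), the integral of U vanishes. *)
Lemma Rintegral_mul_nnsfun_comp d (T : measurableType d) (R : realType)
    (mu : {measure set T -> \bar R}) (D : set T) (U V : T -> R)
    (f : {nnsfun R >-> R}) :
  measurable D -> measurable_fun setT V -> mu.-integrable D (EFin \o U) ->
  (forall B : set R, measurable B -> \int[mu]_(x in D `&` V @^-1` B) U x = 0) ->
  \int[mu]_(x in D) (U x * f (V x)) = 0.
Proof.
move=> mD mV intU U0.
pose S y := V @^-1` (f @^-1` [set y]).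
have mfS y : measurable (f @^-1` [set y]) by exact: measurable_funPTI.
have mS y : measurable (S y) by rewrite -[S y]setTI; exact: mV.
have intS y : mu.-integrable D (EFin \o (U \_ (S y))).
  rewrite -restrict_EFin; apply/integrable_restrict => //.
  by apply: integrableS intU => //; exact: measurableI.
transitivity (fine (\int[mu]_(x in D)
    \sum_(y <- finmap.enum_fset (fset_set (range f))) (y * (U \_ (S y)) x)%:E)).
  congr fine; apply: eq_integral => x _.
  rewrite fimfunE fsbig_finite //= mulr_sumr sumEFin; congr EFin.
  by apply: eq_bigr => y _; rewrite mulrCA patch_indic.
rewrite integral_sum //; last first.
  by move=> y; exact: (integrableZl mD y (intS y)).
rewrite big1 // => y _.
have -> : (fun x => (y * (U \_ (S y)) x)%:E) =
          (fun x => y%:E * (EFin \o (U \_ (S y))) x)%E by [].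
rewrite integralZl // (_ : integral _ _ _ = 0%E) ?mule0 //.
by apply/Rintegral_eq0P => //; rewrite -Rintegral_mkcondr; exact: U0.
Qed.

(** Approximating h from below by simple functions h_n keeps U h_n(V) dominated
    by the integrable U h(V), so the simple case passes to the limit. *)
Lemma Rintegral_mul_ge0_comp d (T : measurableType d) (R : realType)
    (mu : {measure set T -> \bar R}) (D : set T) (U V : T -> R) (h : R -> R) :
  measurable D -> measurable_fun setT V -> measurable_fun setT h ->
  (forall r, 0 <= h r) ->
  mu.-integrable D (EFin \o U) -> mu.-integrable D (EFin \o (U \* (h \o V))) ->
  (forall B : set R, measurable B -> \int[mu]_(x in D `&` V @^-1` B) U x = 0) ->
  \int[mu]_(x in D) (U x * h (V x)) = 0.
Proof.
move=> mD mV mh h0 intU intUh U0.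
have mEh : measurable_fun setT (EFin \o h) by exact/measurable_EFinP.
have Eh0 r : [set: R] r -> (0 <= (EFin \o h) r)%E by rewrite lee_fin.
pose UhV := EFin \o (U \* (h \o V)).
pose g := nnsfun_approx measurableT mEh.
have mU : measurable_fun D U by exact/measurable_EFinP/(measurable_int mu intU).
have mUg n : measurable_fun D (fun x => (U x * g n (V x))%:E).
  apply/measurable_EFinP/measurable_funM => //.
  apply: measurable_funTS; exact: (measurableT_comp _ mV).
have cvgUg x : D x -> (U x * g n (V x))%:E @[n --> \oo] --> (U x * h (V x))%:E.
  move=> Dx; apply: cvg_EFin; first exact: nearW.
  apply: cvgMr; apply: (@fine_cvg _ _ _ _ (fun n => (g n (V x))%:E)).
  exact: (cvg_nnsfun_approx measurableT mEh Eh0).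
have domUg x n : D x ->
    (`| (U x * g n (V x))%:E | <= (abse \o UhV) x)%E.
  move=> Dx; rewrite /= lee_fin !normrM ler_wpM2l //.
  rewrite !ger0_norm // -lee_fin /g nnsfun_approxE; exact: le_approx.
have [_ _] := dominated_convergence mD mUg (measurable_int mu intUh)
  (aeW mu cvgUg) (integrable_abse intUh) (aeW mu (fun x n => domUg x n)).
have -> : [sequence (\int[mu]_(x in D) (U x * g n (V x))%:E)%E]_n = cst 0%E.
  apply/funext => n /=; apply/Rintegral_eq0P => //.
    apply: le_integrable (integrable_abse intUh) => //; first exact: mUg.
    move=> x Dx; by apply: le_trans (domUg x n Dx) _; rewrite /= normr_id.
  exact: Rintegral_mul_nnsfun_comp.
by move/(cvg_lim (@ereal_hausdorff R)); rewrite lim_cst // => /esym /(congr1 fine).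
Qed.

End simple_approximation.

(** This says that U is orthogonal to V as soon as its conditional expectation
    given V vanishes on D, in a form that mentions no conditional expectation
    and does not ask for integrability of V itself, nor for square
    integrability.  The proof splits V into its positive and negative parts. *)
Lemma Rintegral_mul_eq0 d (T : measurableType d) (R : realType)
    (mu : {measure set T -> \bar R}) (D : set T) (U V : T -> R) :
  measurable D -> measurable_fun setT V ->
  mu.-integrable D (EFin \o U) -> mu.-integrable D (EFin \o (U \* V)) ->
  (forall B : set R, measurable B -> \int[mu]_(x in D `&` V @^-1` B) U x = 0) ->
  \int[mu]_(x in D) (U x * V x) = 0.
Proof.
move=> mD mV intU intUV U0.
have mU : measurable_fun D U by exact/measurable_EFinP/(measurable_int mu intU).
(* For s = 1 and s = -1, max (s V) 0 is the positive and negative part of V. *)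
have half (s : R) : `|s| = 1 ->
    mu.-integrable D (EFin \o (U \* ((fun r => Num.max (s * r) 0) \o V))) /\
    \int[mu]_(x in D) (U x * Num.max (s * V x) 0) = 0.
  move=> s1.
  have mh : measurable_fun setT (fun r : R => Num.max (s * r) 0).
    by apply: measurable_maxr => //; exact: mulrl_measurable.
  have h0 r : 0 <= Num.max (s * r) 0 by rewrite le_max lexx orbT.
  have inth : mu.-integrable D
      (EFin \o (U \* ((fun r => Num.max (s * r) 0) \o V))).
    apply: le_integrable intUV => //.
      apply/measurable_EFinP/measurable_funM => //.
      by apply: measurable_funTS; exact: measurableT_comp.
    move=> x Dx; rewrite /= lee_fin !normrM ler_wpM2l // ger0_norm //.
    by rewrite ge_max normr_ge0 andbT -[leRHS]mul1r -s1 -normrM ler_norm.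
  split=> //; exact: (Rintegral_mul_ge0_comp mD mV mh h0).
have [intp eqp] := half 1 (normr1 _).
have [intn eqn] := half (-1) (normrN1 _).
transitivity (\int[mu]_(x in D)
    (U x * Num.max (1 * V x) 0 - U x * Num.max (-1 * V x) 0)).
  apply: eq_Rintegral => x _; rewrite -mulrBr mul1r mulN1r; congr (_ * _).
  case/orP: (le_total 0 (V x)) => V0.
    by rewrite max_l // max_r ?oppr_le0 // subr0.
  by rewrite max_r // max_l ?oppr_ge0 // sub0r opprK.
by rewrite RintegralB // eqp eqn subr0.
Qed.

(** * Conditional expectation and conditional independence *)

Lemma g_sigma_measurable_funP (R : realType) (T : pointedType)
    (G : set (set T)) (f : T -> R) :
  measurable_fun [set: g_sigma_algebraType G] f <->
  forall B : set R, measurable B -> <<s G >> (f @^-1` B).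
Proof.
split=> [mf B mB|mf _ B mB]; last by rewrite setTI; exact: mf.
by rewrite -[_ @^-1` _]setTI; exact: mf.
Qed.

Section conditional_expectation.
Context d (T : measurableType d) (R : realType) (Pr : probability T R).
Implicit Types (G H F : set (set T)) (U V : T -> R).

Lemma Rintegral_cond_exp G U V E : is_cond_exp Pr G U V -> G E ->
  \int[Pr]_(x in E) V x = \int[Pr]_(x in E) U x.
Proof. by case=> _ _ UV /UV; rewrite /Rintegral => ->. Qed.

(** The difference W of two versions integrates to zero over every event of the
    sigma-algebra, in particular over the level sets of sign W; pairing W with
    its sign gives a null integral of |W|. *)
Lemma cond_exp_ae_unique G U V1 V2 : <<s G >> `<=` measurable ->
  is_cond_exp Pr <<s G >> U V1 -> is_cond_exp Pr <<s G >> U V2 ->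
  ae_eq Pr setT V1 V2.
Proof.
move=> Gm c1 c2; have [mV1 i1 _] := c1; have [mV2 i2 _] := c2.
(* h is the sign function, with value 1 at 0. *)
pose W x := V1 x - V2 x; pose h (r : R) : R := 2 * \1_(`[0, +oo[) r - 1.
have mh : measurable_fun setT h.
  by apply: measurable_funB => //; exact: measurable_funM.
have GW : measurable_fun [set: g_sigma_algebraType G] W.
  by apply: measurable_funB; exact/g_sigma_measurable_funP.
have mW : measurable_fun setT W.
  move=> _ B mB; rewrite setTI; apply: Gm.
  by move/g_sigma_measurable_funP: GW; exact.
have iW : Pr.-integrable setT (EFin \o W).
  exact: (integrableB measurableT i1 i2).
have Wh x : W x * (h \o W) x = `|W x|.
  rewrite /h /= indicE mem_setE in_itv /= andbT.
  by case: ger0P => _ /=; rewrite ?mulr0 ?mulr1n; ring.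
have : \int[Pr]_(x in setT) (W x * (h \o W) x) = 0.
  apply: Rintegral_mul_eq0 => //.
  - exact: measurableT_comp.
  - have -> : EFin \o (W \* (h \o W)) = abse \o (EFin \o W).
      by apply/funext => x; rewrite /= -Wh.
    exact: integrable_abse.
  move=> B mB; rewrite setTI.
  have GB : <<s G >> ((h \o W) @^-1` B).
    by move/g_sigma_measurable_funP : (measurableT_comp mh GW); exact.
  rewrite RintegralB ?(Rintegral_cond_exp c1) ?(Rintegral_cond_exp c2) ?subrr //.
  - exact: Gm.
  - by apply: integrableS i1 => //; exact: Gm.
  - by apply: integrableS i2 => //; exact: Gm.
under eq_Rintegral do rewrite Wh.
move/(Rintegral_eq0P measurableT (integrable_abse iW)).
move/(ae_eq_integral_abs Pr measurableT (measurable_int Pr iW)).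
by apply: filterS => x /(_ I) [] /eqP; rewrite subr_eq0 => /eqP.
Qed.

End conditional_expectation.

(** By dominated convergence; it reduces statements involving a version p of a
    conditional probability, whose boundedness is not part of the definition,
    to events on which p is bounded. *)
Lemma Rintegral_truncation_eq0 d (T : measurableType d) (R : realType)
    (mu : {measure set T -> \bar R}) (D : set T) (f p : T -> R) :
  measurable D -> measurable_fun setT p -> mu.-integrable D (EFin \o f) ->
  (forall n, \int[mu]_(x in D `&` [set x | `|p x| <= n%:R]) f x = 0) ->
  \int[mu]_(x in D) f x = 0.
Proof.
move=> mD mp intf f0; pose S n := [set x | `|p x| <= n%:R].
have mS n : measurable (S n).
  have -> : S n = p @^-1` (Num.norm @^-1` `]-oo, n%:R]).
    by apply/seteqP; split=> x /=; rewrite in_itv.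
  rewrite -[_ @^-1` _]setTI; apply: mp => //.
  by rewrite -[_ @^-1` _]setTI; exact: normr_measurable.
have mf : measurable_fun D f by exact/measurable_EFinP/(measurable_int mu intf).
have mfS n : measurable_fun D (fun x => ((f \_ (S n)) x)%:E).
  apply/measurable_EFinP; apply/measurable_restrict => //.
  by apply: measurable_funS mf => //; exact: subIsetl.
have cvgfS x : D x -> ((f \_ (S n)) x)%:E @[n --> \oo] --> (f x)%:E.
  move=> Dx; apply: cvg_near_cst; near=> n; congr EFin.
  by rewrite patchE mem_set //=; near: n; exact: nbhs_infty_ger.
have domfS x n : D x -> (`| ((f \_ (S n)) x)%:E | <= (abse \o (EFin \o f)) x)%E.
  by move=> _; rewrite /= lee_fin patchE; case: ifP; rewrite ?normr0.
have [_ _] := dominated_convergence mD mfS (measurable_int mu intf)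
  (aeW mu cvgfS) (integrable_abse intf) (aeW mu (fun x n => domfS x n)).
have -> : [sequence (\int[mu]_(x in D) ((f \_ (S n)) x)%:E)%E]_n = cst 0%E.
  apply/funext => n /=; apply/Rintegral_eq0P => //.
    apply: le_integrable (integrable_abse intf) => //; first exact: mfS.
    by move=> x Dx; apply: le_trans (domfS x n Dx) _; rewrite /= normr_id.
  by rewrite -Rintegral_mkcondr f0.
by move/(cvg_lim (@ereal_hausdorff R)); rewrite lim_cst // => /esym /(congr1 fine).
Unshelve. all: by end_near. Qed.

Section conditional_independence.
Context d (T : measurableType d) (R : realType) (Pr : probability T R).
Variables F G H : set (set T).
Hypothesis Fm : F `<=` measurable.
Hypothesis Hm : <<s H >> `<=` measurable.
Hypothesis GH : <<s G >> `<=` <<s H >>.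
Hypothesis FHG : cond_indep Pr F <<s H >> <<s G >>.

Let Gm : <<s G >> `<=` measurable. Proof. exact: subset_trans Hm. Qed.

(** Conditionally on G, the larger sigma-algebra H brings no information on A:
    P(A | G) is also a version of P(A | H).  Indeed, for B in H, the integrals
    over the whole space of 1_B P(A | G), of P(B | G) P(A | G) and of
    P(A and B | G) agree.  The version p must serve all B at once, whereas
    conditional independence supplies versions that depend on B; these are
    identified by almost sure uniqueness. *)
Lemma cond_indep_cond_exp A : F A ->
  exists2 p : T -> R, is_cond_exp Pr <<s G >> \1_A p &
    forall B, <<s H >> B ->
      \int[Pr]_(x in B) p x = \int[Pr]_(x in B) (\1_A x : R).
Proof.
move=> FA; have [p [_ [cp _ _]]] := FHG FA (@measurableT _ (g_sigma_algebraType H)).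
exists p => // B HB; have [p1 [pB [c1 cB cAB]]] := FHG FA HB.
have [[mp ip _] [mp1 ip1 _] [mpB ipB _]] := And3 cp c1 cB.
have mA := Fm FA; have mB := Hm HB.
have mfun f : (forall C : set R, measurable C -> <<s G >> (f @^-1` C)) ->
    measurable_fun setT f.
  by move=> mf _ C mC; rewrite setTI; apply: Gm; exact: mf.
have i1B : Pr.-integrable setT (EFin \o (\1_B : T -> R)).
  exact: integrable_indic.
have ip1B : Pr.-integrable setT (EFin \o (p1 \* (\1_B : T -> R))).
  rewrite -patch_indic -restrict_EFin; apply/integrable_restrict => //.
  by rewrite setTI; apply: integrableS ip1.
have ip1pB : Pr.-integrable setT (EFin \o (p1 \* pB)) by case: cAB.
transitivity (\int[Pr]_(x in B) p1 x).
  congr fine; apply: ae_eq_integral => //.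
  - by apply/measurable_EFinP/measurable_funTS/mfun.
  - by apply/measurable_EFinP/measurable_funTS/mfun.
  apply: ae_eq_subset (subsetT B) _; apply: ae_eq_comp.
  exact: cond_exp_ae_unique cp c1.
transitivity (\int[Pr]_(x in setT) (p1 x * pB x)).
  rewrite Rintegral_mkcond patch_indic.
  apply/eqP; rewrite eq_sym -subr_eq0 -RintegralB //; apply/eqP.
  rewrite (@eq_Rintegral _ _ _ Pr _ (fun x => (pB x - \1_B x) * p1 x)); last first.
    by move=> x _; rewrite -mulrBr mulrC.
  apply: Rintegral_mul_eq0 => //; first exact: mfun.
  - exact: (integrableB measurableT ipB i1B).
  - move: (integrableB measurableT ip1pB ip1B); apply: eq_integrable => // x _.
    by rewrite /= -EFinB -mulrBr mulrC.
  move=> C mC; rewrite setTI; have GC := mp1 C mC; have mC' := Gm GC.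
  rewrite RintegralB ?(Rintegral_cond_exp cB) ?subrr //.
  - by apply: integrableS ipB.
  - by apply: integrableS i1B.
rewrite (Rintegral_cond_exp cAB); last first.
  exact: (@measurableT _ (g_sigma_algebraType G)).
by rewrite [RHS]Rintegral_mkcond patch_indic indicI.
Qed.

(** Let p be a version of P(A | G), hence of P(A | H).  As W is H-measurable,
    1_A may be replaced by p in the integral of 1_A W over E; as p is
    G-measurable and W has conditional mean zero given G, the result is zero.
    Truncating to |p| <= n makes all products integrable. *)
Lemma cond_indep_centered W A E :
  (forall B : set R, measurable B -> <<s H >> (W @^-1` B)) ->
  Pr.-integrable setT (EFin \o W) ->
  (forall C, <<s G >> C -> \int[Pr]_(x in C) W x = 0) ->
  F A -> <<s G >> E -> \int[Pr]_(x in A `&` E) W x = 0.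
Proof.
move=> HW iW W0 FA GE; have [p [mp ip _] pA] := cond_indep_cond_exp FA.
have mA := Fm FA; have mE := Gm GE.
have mW : measurable_fun setT W.
  by move=> _ B mB; rewrite setTI; apply: Hm; exact: HW.
have mpT : measurable_fun setT p.
  by move=> _ B mB; rewrite setTI; apply: Gm; exact: mp.
have i1A : Pr.-integrable setT (EFin \o (\1_A : T -> R)).
  exact: integrable_indic.
apply: (Rintegral_truncation_eq0 _ mpT); first exact: measurableI.
  by apply: integrableS iW => //; exact: measurableI.
move=> n; rewrite -setIA; set S := E `&` _.
have GS : <<s G >> S.
  have -> : S = E `&` p @^-1` (Num.norm @^-1` `]-oo, n%:R]).
    by apply/seteqP; split=> x /=; rewrite in_itv.
  apply: (@measurableI _ (g_sigma_algebraType G)) => //.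
  by apply: mp; rewrite -[_ @^-1` _]setTI; exact: normr_measurable.
have mS := Gm GS.
have iWS : Pr.-integrable S (EFin \o W) by apply: integrableS iW.
(* S lies in the event |p| <= n; the bound n + 1 also covers indicators when
   n = 0. *)
have ib (q : T -> R) : measurable_fun setT q ->
    (forall x, S x -> `|q x| <= n.+1%:R) ->
    Pr.-integrable S (EFin \o (q \* W)).
  move=> mq qn; apply: (@le_integrable _ _ _ _ _ mS _
      (EFin \o (fun x => n.+1%:R * W x))).
  - apply/measurable_EFinP; apply: measurable_funTS.
    exact: measurable_funM.
  - move=> x Sx; rewrite /= lee_fin !normrM ler_wpM2r //.
    by apply: le_trans (qn x Sx) _; exact: ler_norm.
  - exact: (integrableZl mS n.+1%:R iWS).
have ind_le1 x : `|\1_A x : R| <= 1.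
  by rewrite indicE; case: (_ \in _); rewrite ?normr1 ?normr0.
have i1W : Pr.-integrable S (EFin \o ((\1_A : T -> R) \* W)).
  apply: ib => [|x _]; first exact: measurable_indic.
  by apply: le_trans (ind_le1 x) _; rewrite ler1n.
have ipW : Pr.-integrable S (EFin \o (p \* W)).
  by apply: ib => // x [_] /= /le_trans; apply; rewrite ler_nat.
rewrite setIC Rintegral_mkcondr patch_indic.
transitivity (\int[Pr]_(x in S) (p x * W x)).
  apply/eqP; rewrite -subr_eq0; apply/eqP.
  rewrite (@eq_Rintegral _ _ _ Pr _ (fun x => \1_A x * W x)); last first.
    by move=> x _; rewrite mulrC.
  rewrite -RintegralB //.
  rewrite (@eq_Rintegral _ _ _ Pr _ (fun x => (\1_A x - p x) * W x)); last first.
    by move=> x _; rewrite -mulrBl.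
  apply: Rintegral_mul_eq0 => //.
  - apply: (integrableS measurableT mS) => //.
    exact: (integrableB measurableT i1A ip).
  - move: (integrableB mS i1W ipW); apply: eq_integrable => // x _.
    by rewrite /= -EFinB -mulrBl.
  move=> B mB; have HSB : <<s H >> (S `&` W @^-1` B).
    apply: (@measurableI _ (g_sigma_algebraType H)); [exact: GH|exact: HW].
  have mSB := Hm HSB; rewrite RintegralB ?pA ?subrr //.
  - by apply: integrableS i1A.
  - by apply: integrableS ip.
rewrite (@eq_Rintegral _ _ _ Pr _ (fun x => W x * p x)); last first.
  by move=> x _; rewrite mulrC.
apply: Rintegral_mul_eq0 => //.
  by move: ipW; apply: eq_integrable => // x _ /=; rewrite mulrC.
move=> B mB; apply: W0.
by apply: (@measurableI _ (g_sigma_algebraType G)) => //; exact: mp.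
Qed.

End conditional_independence.

(** * Covariance conditioned on an event *)

Section event_covariance.
Context d (T : measurableType d) (R : realType) (Pr : probability T R).
Variables (E : set T).
Hypotheses (mE : measurable E) (PE : (0 < Pr E)%E).
Implicit Types U V : T -> R.

Lemma Lfun2_lincomb a U V :
  U \in Lfun Pr 2%:E -> V \in Lfun Pr 2%:E ->
  (fun t => a * U t + V t) \in Lfun Pr 2%:E.
Proof.
move=> U2 V2; have p1 : (1 <= 2%:E :> \bar R)%E by rewrite lee1n.
exact: ((Lfun_submod_closed Pr p1).2 a U V U2 V2).
Qed.

Lemma Lfun2_integrable U : U \in Lfun Pr 2%:E ->
  Pr.-integrable setT (EFin \o U).
Proof.
by move=> U2; apply/Lfun1_integrable/Lfun_subset12 => //; exact: fin_num_measure.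
Qed.

Lemma Lfun2_mul_integrable U V : U \in Lfun Pr 2%:E -> V \in Lfun Pr 2%:E ->
  Pr.-integrable setT (EFin \o (U \* V)).
Proof. by move=> U2 V2; apply/Lfun1_integrable/Lfun2_mul_Lfun1. Qed.

Lemma event_exp_lincomb a U V :
  Pr.-integrable setT (EFin \o U) -> Pr.-integrable setT (EFin \o V) ->
  event_exp Pr E (fun t => a * U t + V t) =
  a * event_exp Pr E U + event_exp Pr E V.
Proof.
move=> iU iV; rewrite /event_exp.
have [iUE iVE] : Pr.-integrable E (EFin \o U) /\ Pr.-integrable E (EFin \o V).
  by split; [apply: integrableS iU|apply: integrableS iV].
rewrite RintegralD //; last exact: (integrableZl mE a iUE).
by rewrite RintegralZl // mulrDl mulrA.
Qed.

Lemma event_exp_cst (c : R) : event_exp Pr E (fun=> c) = c.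
Proof.
rewrite /event_exp Rintegral_cst // mulfK // gt_eqF // fine_gt0 // PE /=.
by rewrite ltey_eq fin_num_measure.
Qed.

Lemma event_covE U V : U \in Lfun Pr 2%:E -> V \in Lfun Pr 2%:E ->
  event_cov Pr E U V =
  event_exp Pr E (U \* V) - event_exp Pr E U * event_exp Pr E V.
Proof.
move=> U2 V2; rewrite /event_cov.
set u := event_exp Pr E U; set v := event_exp Pr E V.
have iU := Lfun2_integrable U2; have iV := Lfun2_integrable V2.
have iUV := Lfun2_mul_integrable U2 V2.
have ic : Pr.-integrable setT (EFin \o (fun=> u * v : R)).
  exact: finite_measure_integrable_cst.
have iVc : Pr.-integrable setT (EFin \o (fun t => - u * V t + u * v)).
  exact: (integrableD measurableT (integrableZl measurableT (- u) iV) ic).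
have iUVc : Pr.-integrable setT
    (EFin \o (fun t => - v * U t + (- u * V t + u * v))).
  exact: (integrableD measurableT (integrableZl measurableT (- v) iU) iVc).
transitivity (event_exp Pr E
    (fun t => 1 * (U \* V) t + (- v * U t + (- u * V t + u * v)))).
  by congr event_exp; apply/funext => t /=; ring.
rewrite !event_exp_lincomb // event_exp_cst -/u -/v; ring.
Qed.

Lemma event_covC U V : event_cov Pr E U V = event_cov Pr E V U.
Proof. by rewrite /event_cov; congr event_exp; apply/funext => t; ring. Qed.

Lemma event_cov_lincombl a U1 U2 V : U1 \in Lfun Pr 2%:E ->
  U2 \in Lfun Pr 2%:E -> V \in Lfun Pr 2%:E ->
  event_cov Pr E (fun t => a * U1 t + U2 t) V =
  a * event_cov Pr E U1 V + event_cov Pr E U2 V.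
Proof.
move=> L1 L2 LV; rewrite !event_covE //; last exact: Lfun2_lincomb.
rewrite (_ : _ \* V = (fun t => a * (U1 \* V) t + (U2 \* V) t)); last first.
  by apply/funext => t /=; ring.
rewrite !event_exp_lincomb //; first by ring.
all: by [exact: Lfun2_integrable|exact: Lfun2_mul_integrable].
Qed.

Lemma Lfun2_sum (I : Type) (s : seq I) (a : I -> R) (X : I -> T -> R) :
  (forall i, X i \in Lfun Pr 2%:E) ->
  (fun t => \sum_(i <- s) a i * X i t) \in Lfun Pr 2%:E.
Proof.
move=> X2; elim: s => [|i s IHs].
  under eq_fun do rewrite big_nil; exact: Lfun_cst.
by under eq_fun do rewrite big_cons; exact: Lfun2_lincomb.
Qed.

Lemma event_cov_suml (I : Type) (s : seq I) (a : I -> R) (X : I -> T -> R) V :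
  (forall i, X i \in Lfun Pr 2%:E) -> V \in Lfun Pr 2%:E ->
  event_cov Pr E (fun t => \sum_(i <- s) a i * X i t) V =
  \sum_(i <- s) a i * event_cov Pr E (X i) V.
Proof.
move=> X2 V2; elim: s => [|i s IHs].
  under eq_fun do rewrite big_nil; rewrite big_nil event_covE ?Lfun_cst //.
  rewrite event_exp_cst mul0r subr0 (_ : _ \* V = fun=> 0) ?event_exp_cst //.
  by apply/funext => t /=; rewrite mul0r.
under eq_fun do rewrite big_cons.
by rewrite big_cons event_cov_lincombl ?IHs // Lfun2_sum.
Qed.

Lemma event_cov_centered_eq0 U V : U \in Lfun Pr 2%:E -> V \in Lfun Pr 2%:E ->
  \int[Pr]_(x in E) U x = 0 -> \int[Pr]_(x in E) (U x * V x) = 0 ->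
  event_cov Pr E U V = 0.
Proof.
by move=> U2 V2 U0 UV0; rewrite event_covE // /event_exp UV0 U0 !mul0r subr0.
Qed.

End event_covariance.

Section generated_sigma_algebra.
Context (T : pointedType) (R : realType) (n : nat) (f : 'I_n -> T -> R).

Lemma g_sigma_preimage_preimage i (B : set R) :
  measurable B -> g_sigma_preimage f (f i @^-1` B).
Proof.
move=> mB; apply: sub_sigma_algebra; rewrite (bigD1 i) //=; left.
by exists B; rewrite ?setTI.
Qed.

Lemma g_sigma_preimage_sub (S : set (set T)) : sigma_algebra setT S ->
  (forall i (B : set R), measurable B -> S (f i @^-1` B)) ->
  g_sigma_preimage f `<=` S.
Proof.
move=> sS fS; apply: smallest_sub => //.
apply: (big_ind (fun A => A `<=` S)) => // [A1 A2 s1 s2 A [/s1|/s2]//|i _].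
by move=> _ [B mB <-]; rewrite setTI; exact: fS.
Qed.

End generated_sigma_algebra.

(** * Residual of the regression on the projection *)

Section regression.
Context d (T : measurableType d) (R : realType) (Pr : probability T R).
Context (D : nat) (X : 'I_D -> {RV Pr >-> R}) (Y : {RV Pr >-> R}).
Variable P : 'M[R]_D.
Hypothesis X2 : forall i, (X i : T -> R) \in Lfun Pr 2%:E.
Hypothesis Y2 : (Y : T -> R) \in Lfun Pr 2%:E.
Hypothesis P_suff : sufficient X Y P.
Hypothesis P_linear : forall i,
  is_cond_exp Pr (g_sigma_preimage (mulRV X P)) (X i) (mulRV X P i).

Lemma mulRVE Q i : mulRV X Q i = (fun t => \sum_j Q i j * X j t).
Proof.
by apply/funext => t; rewrite /mulRV mxE; apply: eq_bigr => j _; rewrite mxE.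
Qed.

Lemma mulRV_Lfun2 Q i : mulRV X Q i \in Lfun Pr 2%:E.
Proof. by rewrite mulRVE; exact: Lfun2_sum. Qed.

(* The residual X - PX, written as a linear combination so that the bilinearity
   lemmas apply to it directly. *)
Let W i : T -> R := fun t => -1 * mulRV X P i t + X i t.

Let W2 i : W i \in Lfun Pr 2%:E.
Proof. exact/Lfun2_lincomb/X2/mulRV_Lfun2. Qed.

Let sigmaX : set (set T) := g_sigma_preimage (fun i => X i : T -> R).
Let sigmaPX : set (set T) := g_sigma_preimage (mulRV X P).

Let sigmaXm : sigmaX `<=` measurable.
Proof.
apply: g_sigma_preimage_sub; first exact: sigma_algebra_measurable.
by move=> i B mB; exact: measurable_funPTI.
Qed.

Lemma mulRV_sigmaX Q i (B : set R) :
  measurable B -> g_sigma_preimage (fun i => X i : T -> R) (mulRV X Q i @^-1` B).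
Proof.
move: B; apply/g_sigma_measurable_funP; rewrite mulRVE; apply: measurable_sum => j.
apply: measurable_funM => //; apply/g_sigma_measurable_funP => C mC.
exact: (@g_sigma_preimage_preimage _ _ _ (fun i => X i : T -> R)).
Qed.

Let sigmaPX_sub : sigmaPX `<=` sigmaX.
Proof.
apply: g_sigma_preimage_sub; first exact: smallest_sigma_algebra.
by move=> i B; exact: mulRV_sigmaX.
Qed.

Lemma residual_integral_eq0 i (A G : set T) :
  preimage_set_system setT Y measurable A -> sigmaPX G ->
  \int[Pr]_(x in A `&` G) W i x = 0.
Proof.
apply: (cond_indep_centered _ sigmaXm sigmaPX_sub P_suff).
- by move=> _ [B mB <-]; rewrite setTI; exact: measurable_funPTI.
- apply/g_sigma_measurable_funP; apply: measurable_funD.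
    apply: measurable_funM => //; apply/g_sigma_measurable_funP.
    by move=> B; exact: mulRV_sigmaX.
  apply/g_sigma_measurable_funP => B mB.
  exact: (@g_sigma_preimage_preimage _ _ _ (fun i => X i : T -> R)).
- exact: Lfun2_integrable.
move=> C GC; have mC : measurable C by apply: sigmaXm; exact: sigmaPX_sub.
have iX : Pr.-integrable C (EFin \o X i).
  by apply: integrableS (Lfun2_integrable (X2 i)).
have iPX : Pr.-integrable C (EFin \o mulRV X P i).
  by apply: integrableS (Lfun2_integrable (mulRV_Lfun2 P i)).
rewrite RintegralD //; last exact: (integrableZl mC (-1) iPX).
by rewrite RintegralZl // (Rintegral_cond_exp (P_linear i) GC) mulN1r addNr.
Qed.

Let event_Y (B : set R) : measurable B ->
  preimage_set_system setT Y measurable (Y @^-1` B).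
Proof. by move=> mB; exists B; rewrite ?setTI. Qed.

(** The hypothesis on V makes the level sets of V inside the event products of
    an event of sigma(Y) and an event of sigma(PX), which is what V = Y and
    V = PX have in common. *)
Lemma residual_cov_eq0 i (B : set R) (V : T -> R) : measurable B ->
  (0 < Pr (Y @^-1` B))%E -> V \in Lfun Pr 2%:E ->
  (forall C : set R, measurable C -> exists A G,
    [/\ preimage_set_system setT Y measurable A, sigmaPX G &
        Y @^-1` B `&` V @^-1` C = A `&` G]) ->
  event_cov Pr (Y @^-1` B) (W i) V = 0.
Proof.
move=> mB PB V2 VC; have mE : measurable (Y @^-1` B).
  exact: measurable_funPTI.
have mV : measurable_fun setT V.
  by move: V2; rewrite inE => /andP[/[!inE]].
apply: event_cov_centered_eq0 => //.
  rewrite -[Y @^-1` B]setIT; apply: residual_integral_eq0; first exact: event_Y.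
  exact: (@measurableT _ (g_sigma_algebraType _)).
apply: Rintegral_mul_eq0 => //.
- by apply: integrableS (Lfun2_integrable (W2 i)).
- by apply: integrableS (Lfun2_mul_integrable (W2 i) V2).
- by move=> C /VC[A [G [FA GG ->]]]; exact: residual_integral_eq0.
Qed.

Lemma residual_covY_eq0 i (B : set R) : measurable B ->
  (0 < Pr (Y @^-1` B))%E -> event_cov Pr (Y @^-1` B) (W i) Y = 0.
Proof.
move=> mB PB; apply: residual_cov_eq0 => // C mC.
exists (Y @^-1` (B `&` C)), setT; split; last by rewrite setIT.
  by apply: event_Y; exact: measurableI.
exact: (@measurableT _ (g_sigma_algebraType _)).
Qed.

Lemma residual_cov_mulRV_eq0 i j (B : set R) : measurable B ->
  (0 < Pr (Y @^-1` B))%E -> event_cov Pr (Y @^-1` B) (W i) (mulRV X P j) = 0.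
Proof.
move=> mB PB; apply: residual_cov_eq0 => //; first exact: mulRV_Lfun2.
move=> C mC; exists (Y @^-1` B), (mulRV X P j @^-1` C); split => //.
  exact: event_Y.
exact: g_sigma_preimage_preimage.
Qed.

Let cov_mulRV (B : set R) Q i (V : T -> R) : measurable B ->
  (0 < Pr (Y @^-1` B))%E -> V \in Lfun Pr 2%:E ->
  event_cov Pr (Y @^-1` B) (mulRV X Q i) V =
  \sum_j Q i j * event_cov Pr (Y @^-1` B) (X j) V.
Proof.
move=> mB PB V2; rewrite mulRVE.
apply: (event_cov_suml _ PB _ (fun j => Q i j) X2 V2).
exact: measurable_funPTI.
Qed.

Let cov_X (B : set R) i (V : T -> R) : measurable B ->
  (0 < Pr (Y @^-1` B))%E -> V \in Lfun Pr 2%:E ->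
  event_cov Pr (Y @^-1` B) (W i) V = 0 ->
  event_cov Pr (Y @^-1` B) (X i) V =
  event_cov Pr (Y @^-1` B) (mulRV X P i) V.
Proof.
move=> mB PB V2; rewrite event_cov_lincombl //.
- by move/eqP; rewrite mulN1r addrC subr_eq0 => /eqP.
- exact: measurable_funPTI.
- exact: mulRV_Lfun2.
Qed.

(** Replacing X by PX does not change its covariance with Y, the residual being
    uncorrelated with Y. *)
Lemma cross_cov_fixed (B : set R) : measurable B -> (0 < Pr (Y @^-1` B))%E ->
  P *m (\col_i event_cov Pr (Y @^-1` B) (X i) Y) =
  \col_i event_cov Pr (Y @^-1` B) (X i) Y.
Proof.
move=> mB PB; apply/colP => i; rewrite !mxE cov_X //; last first.
  exact: residual_covY_eq0.
by rewrite cov_mulRV //; apply: eq_bigr => j _; rewrite mxE.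
Qed.

(** Cov(X, PX) = Cov(PX, PX) on the event reads S P = P S P, whose right-hand
    side is symmetric; hence so is S P, and S P = P S. *)
Lemma Sigma_commute (B : set R) : measurable B -> (0 < Pr (Y @^-1` B))%E ->
  P^T = P -> P *m Sigma_ X Y B = Sigma_ X Y B *m P.
Proof.
move=> mB PB Psym; set S := Sigma_ X Y B.
have Ssym : S^T = S by apply/matrixP => i j; rewrite !mxE event_covC.
have SE i (Q : 'M[R]_D) j :
    event_cov Pr (Y @^-1` B) (X i) (mulRV X Q j) = (S *m Q^T) i j.
  rewrite event_covC cov_mulRV // mxE; apply: eq_bigr => k _.
  by rewrite !mxE mulrC event_covC.
have SP : S *m P = P *m S *m P.
  apply/matrixP => i j; rewrite -[in LHS]Psym -SE cov_X ?mulRV_Lfun2 //; last first.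
    exact: residual_cov_mulRV_eq0.
  rewrite cov_mulRV ?mulRV_Lfun2 // -mulmxA mxE; apply: eq_bigr => k _.
  by rewrite SE Psym.
rewrite SP -[LHS]trmxK trmx_mul Ssym Psym SP.
by rewrite !trmx_mul Psym Ssym mulmxA.
Qed.

Lemma b_fixed (B : set R) : is_orthoproj P -> measurable B ->
  (0 < Pr (Y @^-1` B))%E -> P *m b_ X Y B = b_ X Y B.
Proof.
move=> oP mB PB; apply: mpinv_orthoproj_fixed => //.
  by apply: Sigma_commute => //; case: oP.
exact: cross_cov_fixed.
Qed.

End regression.

(** * Column space of the outer product matrix *)

Theorem proposition3 (disp : measure_display) (T : measurableType disp)
    (R : realType) (Pr : probability T R) (D d : nat)
    (X : 'I_D -> {RV Pr >-> R}) (Y : {RV Pr >-> R}) (A : 'M[R]_(D, d))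
    (X2 : forall i, (X i : T -> R) \in Lfun Pr 2%:E)
    (Y2 : (Y : T -> R) \in Lfun Pr 2%:E)
    (A_orthonormal : A^T *m A = 1%:M)
    (A_minimal : minimal_sufficient X Y (A *m A^T))
    (A_linear : forall i, is_cond_exp Pr (g_sigma_preimage (mulRV X (A *m A^T)))
                            (X i) (mulRV X (A *m A^T) i)) :
  forall (J : nat) (L : 'I_J -> set R), level_partition Y L ->
    [/\ forall l, colspace A (b_ X Y (L l)),
        colspace (M_ X Y L) `<=` colspace A &
        0 < lambda d (M_ X Y L) -> colspace (M_ X Y L) = colspace A].
Proof.
move=> J L [_ Lmeas Lpos]; have [AAproj AAsuff _] := A_minimal.
have Ab l : A *m A^T *m b_ X Y (L l) = b_ X Y (L l).
  have [B mB LB] := Lmeas l; have YLB : Y @^-1` L l = Y @^-1` B.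
    by rewrite LB preimage_setI preimage_range setTI.
  have PB : (0 < Pr (Y @^-1` B))%E by rewrite -YLB.
  rewrite /b_ /Sigma_ YLB.
  exact: (b_fixed X2 Y2 AAsuff A_linear AAproj mB PB).
have AM : M_ X Y L = A *m (A^T *m M_ X Y L).
  rewrite mulmxA mulmx_sumr; apply: eq_bigr => l _.
  by rewrite -scalemxAr mulmxA Ab.
have Msym : (M_ X Y L)^T = M_ X Y L.
  rewrite linear_sum /=; apply: eq_bigr => l _.
  by rewrite linearZ /= trmx_mul trmxK.
split=> [l||lam_gt0].
- by exists (A^T *m b_ X Y (L l)) => //; rewrite mulmxA.
- by rewrite AM; exact: colspace_mulmx.
- rewrite AM; apply: colspace_mulmx_full; rewrite -AM.
  exact: lambda_gt0_rank Msym lam_gt0.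
Qed.
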